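(* Let $\mathbb{F}$ be an algebraically closed field of characteristic $0$, let $J\in\{\{0\},\mathbb{N}\}$, let $\Delta$ be an additive subgroup of $\mathbb{F}$ such that $J+\Delta\neq\{0\}$ (i.e. $\Delta$ and $J$ are not both $\{0\}$), let $b\in\mathbb{F}$, and let $(\mathcal{N},\circ)$ be the Novikov algebra over $\mathbb{F}$ with basis $\{u_{\alpha,i}\mid\alpha\in\Delta,\ i\in J\}$ and operation $u\circ v=u\cdot\partial(v)+\xi\cdot u\cdot v$ with $\xi=b$, as described in the context. Then any irreducible $\mathcal{N}$-module $M$ for which the left action $L_M(u_{0,0}):w\mapsto u_{0,0}\circ w$ is locally finite is isomorphic to $M(\lambda)$ for some $\lambda\in\mathbb{F}$.
   Context: $\mathbb{N}$ denotes the nonnegative integers. A Novikov algebra over $\mathbb{F}$ is an $\mathbb{F}$-vector space $\mathcal{N}$ with a bilinear operation $\circ$ such that for all $u,v,w$: (N1) $(u\circ v)\circ w=(u\circ w)\circ v$ and (N2) $(u\circ v)\circ w-u\circ(v\circ w)=(v\circ u)\circ w-v\circ(u\circ w)$. A module of $\mathcal{N}$ is a vector space $M$ with bilinear left and right actions $\mathcal{N}\times M\to M$, $(u,w)\mapsto u\circ w$, and $M\times\mathcal{N}\to M$, $(w,u)\mapsto w\circ u$, such that (N1) and (N2) hold whenever one of the three elements lies in $M$ and the other two lie in $\mathcal{N}$. A submodule is a subspace $V\subset M$ with $u\circ V\subset V$ and $V\circ u\subset V$ for all $u\in\mathcal{N}$. $M$ is called irreducible if it does not contain any proper nonzero submodule.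 A module isomorphism is a linear bijection commuting with both the left and right actions. A linear transformation $T$ of a vector space $V$ is locally finite if for every $v\in V$ the subspace $\sum_{m=0}^{\infty}\mathbb{F}T^m(v)$ is finite-dimensional. Let $\mathcal{A}$ be the $\mathbb{F}$-vector space with basis $\{u_{\alpha,i}\mid\alpha\in\mathbb{F},\ i\in J\}$, with commutative associative product $u_{\alpha,i}\cdot u_{\beta,j}=u_{\alpha+\beta,i+j}$ (identity $u_{0,0}$) and the linear map $\partial(u_{\alpha,j})=\alpha u_{\alpha,j}+j u_{\alpha,j-1}$ (last term $0$ when $j=0$). With $\xi=b\in\mathbb{F}$, define $u\circ v=u\cdot\partial(v)+b\,u\cdot v$ for $u,v\in\mathcal{A}$; this makes $\mathcal{A}$ a Novikov algebra. Set $\mathcal{N}=\sum_{\alpha\in\Delta,\,i\in J}\mathbb{F}u_{\alpha,i}$, a subalgebra of $(\mathcal{A},\circ)$. For $\lambda\in\mathbb{F}$ set $M(\lambda)=\sum_{\alpha\in\Delta,\,i\in J}\mathbb{F}u_{\alpha+\lambda,i}\subset\mathcal{A}$, which is an $\mathcal{N}$-module under left and right multiplication by elements of $\mathcal{N}$ in $(\mathcal{A},\circ)$.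
   Formalization: The irreducible module M is additionally assumed to have a nonzero left or right action; this excludes only the zero module and the one-dimensional module with zero actions, for which the claim as worded fails. *)

(* Defs.v *)
From HB Require Import structures.
From mathcomp Require Import all_boot all_order all_algebra.
From mathcomp Require Import finmap.
From mathcomp.multinomials Require Import monalg.

Set Implicit Arguments.
Unset Strict Implicit.
Unset Printing Implicit Defensive.

Import GRing.Theory.
Local Open Scope ring_scope.

(* Both axioms of a Novikov algebra are symmetric in two of their three       *)
(* arguments: (N1) in the last two and (N2) in the first two. Requiring them  *)
(* whenever exactly one argument lies in M thus amounts to two equations for  *)
(* each axiom, depending on whether or not that argument is exchanged.        *)
Record novikov_module (F : fieldType) (N M : lmodType F) (op : N -> N -> N)
    (l : N -> M -> M) (r : M -> N -> M) : Prop := NovikovModule {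
  nm_N1_fix : forall w u v, r (r w u) v = r (r w v) u;
  nm_N1_swap : forall u w v, r (l u w) v = l (op u v) w;
  nm_N2_swap : forall w v x,
    r (r w v) x - r w (op v x) = r (l v w) x - l v (r w x);
  nm_N2_fix : forall u v w,
    l (op u v) w - l u (l v w) = l (op v u) w - l v (l u w)
}.

Record novikov_submodule (F : fieldType) (N M : lmodType F)
    (l : N -> M -> M) (r : M -> N -> M) (V : M -> Prop) : Prop :=
    NovikovSubmodule {
  ns_zero : V 0;
  ns_lin : forall a x y, V x -> V y -> V (a *: x + y);
  ns_left : forall u x, V x -> V (l u x);
  ns_right : forall u x, V x -> V (r x u)
}.

Definition irreducible_module (F : fieldType) (N M : lmodType F)
    (l : N -> M -> M) (r : M -> N -> M) : Prop :=
  ~ exists V : M -> Prop, [/\ novikov_submodule l r V,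
      exists x, ~ V x & exists2 x, V x & x <> 0].

(* The zero module, and a one-dimensional module on which both actions vanish *)
(* identically, have no proper nonzero submodule either. Such degenerate      *)
(* modules are excluded by the following condition.                           *)
Definition nonzero_action (F : fieldType) (N M : lmodType F)
    (l : N -> M -> M) (r : M -> N -> M) : Prop :=
  exists u w, l u w <> 0 \/ r w u <> 0.

Definition module_isomorphic (F : fieldType) (N M M' : lmodType F)
    (l : N -> M -> M) (r : M -> N -> M)
    (l' : N -> M' -> M') (r' : M' -> N -> M') : Prop :=
  exists f : {linear M -> M'}, [/\ bijective f,
    forall u w, f (l u w) = l' u (f w) & forall w u, f (r w u) = r' (f w) u].

Definition finite_dimensional (F : fieldType) (V : lmodType F)
    (S : V -> Prop) : Prop :=
  exists s : seq V, (forall x, x \in s -> S x) /\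
    forall x, S x -> exists c : nat -> F, x = \sum_(i < size s) c i *: s`_i.

Definition iterate_span (F : fieldType) (V : lmodType F) (T : V -> V) (v : V)
    : V -> Prop :=
  fun x => exists n (c : nat -> F), x = \sum_(m < n) c m *: iter m T v.

Definition locally_finite (F : fieldType) (V : lmodType F) (T : V -> V)
    : Prop :=
  forall v, finite_dimensional (iterate_span T v).

Variant exponents := ExpZero | ExpNat.

Coercion exponents_pred (J : exponents) : {pred nat} :=
  [pred i | if J is ExpZero then i == 0%N else true].

(* The basis vector u_{a,i} is << (a, i) >>, and x@_(a, i) is the coefficient *)
(* of u_{a,i} in x. The key type does not carry the structure which monalg    *)
(* requires to define a product, as there 1 would be the only invertible key. *)
Notation algA F := {malg F%type[(F%type * nat)%type]}.

HB.lock Definition mul_algA (F : fieldType) (x y : algA F) : algA F :=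
  \sum_(k <- msupp x) \sum_(k' <- msupp y)
    << x@_k * y@_k' *g (k.1 + k'.1, (k.2 + k'.2)%N) >>.
Canonical mul_algA_unlockable := Unlockable mul_algA.unlock.

HB.lock Definition der_algA (F : fieldType) (x : algA F) : algA F :=
  \sum_(k <- msupp x) (<< x@_k * k.1 *g k >>
                       + << x@_k * k.2%:R *g (k.1, k.2.-1) >>).
Canonical der_algA_unlockable := Unlockable der_algA.unlock.

HB.lock Definition circ_algA (F : fieldType) (b : F) (x y : algA F) : algA F :=
  mul_algA x (der_algA y) + b *: mul_algA x y.
Canonical circ_algA_unlockable := Unlockable circ_algA.unlock.

Section AlgebraA.
Variable F : fieldType.
Implicit Types (x y : algA F) (b : F) (S : {pred F * nat}).

Definition spanned_by S : {pred algA F} :=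
  [pred x : algA F | all [in S] (msupp x)].

Lemma spanned_byP S x :
  reflect (forall k, k \notin S -> x@_k = 0) (x \in spanned_by S).
Proof.
apply: (iffP allP) => [xS k|xS k]; last first.
  by rewrite -mcoeff_neq0; apply: contraNT => /xS ->.
by move=> kS; apply/eqP; rewrite mcoeff_eq0; apply: contra kS => /xS.
Qed.

Fact spanned_by_submod_closed S : submod_closed (spanned_by S).
Proof.
split=> [|a x y /spanned_byP xS /spanned_byP yS]; apply/spanned_byP => k kS.
  by rewrite mcoeff0.
by rewrite mcoeffD mcoeffZ xS // yS // mulr0 addr0.
Qed.

HB.instance Definition _ S := GRing.isSubmodClosed.Build F (algA F)
  (spanned_by S) (spanned_by_submod_closed S).

Record spanA S := SpanA {
  spanA_val :> algA F;
  spanA_valP : spanA_val \in spanned_by S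
}.

HB.instance Definition _ S := [isSub for @spanA_val S].
HB.instance Definition _ S := [Choice of spanA S by <:].
HB.instance Definition _ S :=
  [SubChoice_isSubLmodule of spanA S by <:].

Lemma spanned_byU S c k : k \in S -> << c *g k >> \in spanned_by S.
Proof.
move=> kS; apply/spanned_byP => k' k'S; rewrite mcoeffU.
by case: eqP k'S => // <-; rewrite kS.
Qed.

Lemma mul_algA_spanned S1 S2 S3 x y :
    (forall k k', k \in S1 -> k' \in S2 ->
       (k.1 + k'.1, (k.2 + k'.2)%N) \in S3) ->
  x \in spanned_by S1 -> y \in spanned_by S2 -> mul_algA x y \in spanned_by S3.
Proof.
move=> S12 /allP xS /allP yS; rewrite unlock big_seq rpred_sum // => k kx.
rewrite big_seq rpred_sum // => k' ky.
by apply: spanned_byU; apply: S12; [apply: xS | apply: yS].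
Qed.

Lemma der_algA_spanned S x : (forall k, k \in S -> (k.1, k.2.-1) \in S) ->
  x \in spanned_by S -> der_algA x \in spanned_by S.
Proof.
move=> Sd /allP xS; rewrite unlock big_seq rpred_sum // => k /xS /= kS.
by rewrite rpredD // spanned_byU // Sd.
Qed.

Lemma circ_algA_spanned S1 S2 S3 b x y :
    (forall k, k \in S2 -> (k.1, k.2.-1) \in S2) ->
    (forall k k', k \in S1 -> k' \in S2 ->
       (k.1 + k'.1, (k.2 + k'.2)%N) \in S3) ->
  x \in spanned_by S1 -> y \in spanned_by S2 ->
  circ_algA b x y \in spanned_by S3.
Proof.
move=> Sd S12 xS yS; rewrite unlock rpredD ?rpredZ //.
  exact: mul_algA_spanned S12 xS (der_algA_spanned Sd yS).
exact: mul_algA_spanned S12 xS yS.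
Qed.

End AlgebraA.

Section Algebra.
Variables (F : fieldType) (Delta : zmodClosed F) (J : exponents).

Lemma exponents0 : 0%N \in (J : {pred nat}).
Proof. by rewrite inE; case: J. Qed.

Lemma exponentsD i j : i \in (J : {pred nat}) -> j \in (J : {pred nat}) ->
  (i + j)%N \in (J : {pred nat}).
Proof. by rewrite !inE; case: J => // /eqP-> /eqP->. Qed.

Lemma exponents_pred_closed i :
  i \in (J : {pred nat}) -> i.-1 \in (J : {pred nat}).
Proof. by rewrite !inE; case: J => // /eqP->. Qed.

Definition coset_keys (lam : F) : {pred F * nat} :=
  [pred k | (k.1 - lam \in Delta) && (k.2 \in (J : {pred nat}))].

Lemma coset_keys_der lam (k : F * nat) :
  k \in coset_keys lam -> (k.1, k.2.-1) \in coset_keys lam.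
Proof. by case/andP=> kD kJ; rewrite inE /= kD exponents_pred_closed. Qed.

Lemma coset_keysD lam mu (k k' : F * nat) :
    k \in coset_keys lam -> k' \in coset_keys mu ->
  (k.1 + k'.1, (k.2 + k'.2)%N) \in coset_keys (lam + mu).
Proof.
case/andP=> kD kJ /andP[kD' kJ']; rewrite inE /= exponentsD // andbT.
by rewrite opprD addrACA rpredD.
Qed.

Definition keysN : {pred F * nat} :=
  [pred k | (k.1 \in Delta) && (k.2 \in (J : {pred nat}))].

Lemma keysNE : keysN =i coset_keys 0.
Proof. by move=> k; rewrite !inE subr0. Qed.

Definition algN : lmodType F := spanA keysN.
Definition modM (lam : F) : lmodType F := spanA (coset_keys lam).

Fact u00_spanned : << (0, 0%N) >> \in @spanned_by F keysN.
Proof. by apply: spanned_byU; rewrite inE /= rpred0 exponents0. Qed.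

Definition u00 : algN := SpanA u00_spanned.

Variable b : F.

Fact circN_spanned (u v : algN) : circ_algA b u v \in spanned_by keysN.
Proof.
apply: circ_algA_spanned (spanA_valP u) (spanA_valP v) => [k|k k'].
  by rewrite !keysNE; apply: coset_keys_der.
by rewrite !keysNE -{3}[0]addr0; apply: coset_keysD.
Qed.

Definition circN (u v : algN) : algN := SpanA (circN_spanned u v).

Variable lam : F.

Fact lactM_spanned (u : algN) (w : modM lam) :
  circ_algA b u w \in spanned_by (coset_keys lam).
Proof.
apply: circ_algA_spanned (spanA_valP u) (spanA_valP w) => [k|k k'].
  exact: coset_keys_der.
by rewrite keysNE -[in X in _ -> _ -> X](add0r lam); apply: coset_keysD.
Qed.

Fact ractM_spanned (w : modM lam) (u : algN) :
  circ_algA b w u \in spanned_by (coset_keys lam).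
Proof.
apply: circ_algA_spanned (spanA_valP w) (spanA_valP u) => [k|k k'].
  by rewrite !keysNE; apply: coset_keys_der.
by rewrite keysNE -[in X in _ -> _ -> X](addr0 lam); apply: coset_keysD.
Qed.

Definition lactM (u : algN) (w : modM lam) : modM lam :=
  SpanA (lactM_spanned u w).

Definition ractM (w : modM lam) (u : algN) : modM lam :=
  SpanA (ractM_spanned w u).

End Algebra.

(* Main.v *)
(* Write D = d + b, so that u o v = u . D v, and 1 = u_{0,0}. Kernels of      *)
(* operators that intertwine the two actions up to sign are submodules, so    *)
(* irreducibility forces the right action of 1 to be b and the right action   *)
(* of every element of ker D to be 0. Hence the right action factors through  *)
(* D, and we obtain operators P_y with R_x = P_{D x}. When J = {0} and -b is  *)
(* in Delta, the image of D misses u_{-b,0} only, and P at u_{-b,0} is        *)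
(* defined as P_{u_{g,0}} P_{u_{-b-g,0}} for a generic g in Delta. With       *)
(* T = L_1 one finds L_y = P_y T and [T, P_y] = P_{d y}. The defect           *)
(* E(x, y) = P_x P_y - P_{xy} satisfies E(D x, y) + E(x, d y) = 0, which      *)
(* gives E = 0 by induction on degrees; then P_1 is an injective idempotent,  *)
(* so P_1 = 1. A T-eigenvector w with eigenvalue lam + b exists by local      *)
(* finiteness, and u_{lam+a,i} |-> P_{u_{a,i}} w is a morphism from M(lam) to *)
(* M. It is onto by irreducibility, and injective since a nonzero kernel      *)
(* would contain an eigenvector of d, that is, some u_{c,0}, and P at u_{c,0} *)
(* is invertible.                                                             *)

Require Import Defs.
From HB Require Import structures.
From mathcomp Require Import all_boot all_order all_algebra.
From mathcomp Require Import finmap boolp ring.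
From mathcomp.multinomials Require Import monalg.

Set Implicit Arguments.
Unset Strict Implicit.
Unset Printing Implicit Defensive.

Import GRing.Theory.
Local Open Scope ring_scope.

(** In [M(lam)] an element [x] acts on the right as multiplication by [D x], and on the left as
    multiplication by [x] after [D]. The proof recovers these multiplications on an abstract
    irreducible module from the right action alone. Since the kernel of [D] acts by 0 on the right
    ([r_ker_db]), operators [mult] with [r w x = mult (D x) w] can be constructed ([r_mult]), and
    the left action is then governed by the single operator [T = l one] ([l_mult], [l_one_mult]).
    Axiom N2 becomes a recursion for the failure of [mult] to be multiplicative ([mult_defect_db]).
    It forces this failure to be 0 except at a few exponents when J = {0}, which
    [multiplicative_extension] settles; the outcome is [mult_mulN], and irreducibility adds [mult1].
    Thus the module is a unital module over the commutative algebra N with an operator [T]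
    compatible with the derivation. An eigenvector of [T], given by local finiteness over an
    algebraically closed field, generates a copy of [M(lam)] ([orbit_map_surj], [orbit_map_eq0]). *)

(** * Vector identities by comparison of coefficients *)

Inductive mod_expr (F : Type) :=
  | MVar of nat
  | MZero
  | MAdd of mod_expr F & mod_expr F
  | MOpp of mod_expr F
  | MScale of F & mod_expr F.
Arguments MVar {F}.
Arguments MZero {F}.

Section ModExpr.
Variables (F : fieldType) (V : lmodType F) (env : seq V).

Fixpoint mod_eval (e : mod_expr F) : V :=
  match e with
  | MVar j => env`_j
  | MZero => 0
  | MAdd e1 e2 => mod_eval e1 + mod_eval e2
  | MOpp e1 => - mod_eval e1
  | MScale c e1 => c *: mod_eval e1
  end.

Fixpoint mod_coef (e : mod_expr F) (i : nat) : F :=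
  match e with
  | MVar j => (j == i)%:R
  | MZero => 0
  | MAdd e1 e2 => mod_coef e1 i + mod_coef e2 i
  | MOpp e1 => - mod_coef e1 i
  | MScale c e1 => c * mod_coef e1 i
  end.

(** An explicit conjunction, so that reduction leaves one scalar identity per atom. *)
Fixpoint coef_eq (e1 e2 : mod_expr F) (n : nat) : Prop :=
  if n is n'.+1 then mod_coef e1 n' = mod_coef e2 n' /\ coef_eq e1 e2 n'
  else True.

Lemma mod_evalE e : mod_eval e = \sum_(i < size env) mod_coef e i *: env`_i.
Proof.
elim: e => [j||e1 IH1 e2 IH2|e IH|c e IH] /=.
- have [jn|jn] := ltnP j (size env).
    rewrite (bigD1 (Ordinal jn)) //= eqxx scale1r big1 ?addr0 // => i.
    by rewrite -val_eqE /= eq_sym => /negPf ->; rewrite scale0r.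
  rewrite nth_default // big1 // => i _.
  by rewrite gtn_eqF ?scale0r // (leq_trans (ltn_ord i)).
- by rewrite big1 // => i _; rewrite scale0r.
- by rewrite IH1 IH2 -big_split; apply: eq_bigr => i _; rewrite scalerDl.
- by rewrite IH -sumrN; apply: eq_bigr => i _; rewrite scaleNr.
- by rewrite IH scaler_sumr; apply: eq_bigr => i _; rewrite scalerA.
Qed.

Lemma mod_eval_eq e1 e2 : coef_eq e1 e2 (size env) -> mod_eval e1 = mod_eval e2.
Proof.
rewrite !mod_evalE => e12; apply: eq_bigr => i _; congr (_ *: _).
elim: (size env) (nat_of_ord i) (ltn_ord i) e12 => // n IH j.
by rewrite ltnS leq_eqVlt => /predU1P[-> []|/IH + []].
Qed.

End ModExpr.

Ltac mod_index x env :=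
  lazymatch env with
  | x :: _ => constr:(0%N)
  | _ :: ?env' => let n := mod_index x env' in constr:(n.+1)
  end.

Ltac mod_mem x env :=
  lazymatch env with
  | nil => constr:(false)
  | x :: _ => constr:(true)
  | _ :: ?env' => mod_mem x env'
  end.

Ltac mod_atoms t env :=
  lazymatch t with
  | (?x + ?y)%R => let env' := mod_atoms x env in mod_atoms y env'
  | (- ?x)%R => mod_atoms x env
  | (_ *: ?x)%R => mod_atoms x env
  | 0%R => env
  | ?x => let m := mod_mem x env in
    lazymatch m with true => env | false => constr:(x :: env) end
  end.

Ltac mod_reify F t env :=
  lazymatch t with
  | (?x + ?y)%R => let x' := mod_reify F x env in
    let y' := mod_reify F y env in constr:(@MAdd F x' y')
  | (- ?x)%R => let x' := mod_reify F x env in constr:(@MOpp F x')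
  | (?c *: ?x)%R => let x' := mod_reify F x env in constr:(@MScale F c x')
  | 0%R => constr:(@MZero F)
  | ?x => let i := mod_index x env in constr:(@MVar F i)
  end.

(* Proves an identity between linear combinations of vectors by comparing the *)
(* coefficients of each vector with ring.                                     *)
Ltac module_ring :=
  lazymatch goal with
  | |- @eq ?T ?x ?y =>
    let env0 := mod_atoms x (@nil T) in
    let env := mod_atoms y env0 in
    let F := lazymatch goal with H : fieldType |- _ => H end in
    let x' := mod_reify F x env in
    let y' := mod_reify F y env in
    apply: (@mod_eval_eq _ _ env x' y'); rewrite /=; repeat split; ring
  end.

(** * The commutative algebra A and its derivation *)
Section LinearExtension.
Variables (F : fieldType) (V : lmodType F).
Implicit Types (f : F * nat -> V) (x y : algA F).

Definition lin_ext f x : V := \sum_(k <- msupp x) x@_k *: f k.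

Lemma lin_extEw f x (d : {fset F * nat}) :
  (msupp x `<=` d)%fset -> lin_ext f x = \sum_(k <- d) x@_k *: f k.
Proof.
move=> xd; rewrite /lin_ext (big_fset_incl _ xd) // => k _.
by move/mcoeff_outdom ->; rewrite scale0r.
Qed.

Lemma lin_extP f a x y :
  lin_ext f (a *: x + y) = a *: lin_ext f x + lin_ext f y.
Proof.
pose d := (msupp x `|` msupp y)%fset.
have xd : (msupp x `<=` d)%fset by apply: fsubsetUl.
have yd : (msupp y `<=` d)%fset by apply: fsubsetUr.
have axyd : (msupp (a *: x + y) `<=` d)%fset.
  apply: fsubset_trans (msuppD_le _ _) _; apply: fsetUSS (fsubset_refl _).
  exact: msuppZ_le.
rewrite !(@lin_extEw _ _ d) // scaler_sumr -big_split.
by apply: eq_bigr => k _; rewrite mcoeffD mcoeffZ scalerDl scalerA.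
Qed.

HB.instance Definition _ f := GRing.isLinear.Build F (algA F) V *:%R (lin_ext f)
  (fun a x y => lin_extP f a x y).

Lemma lin_extU f k c : lin_ext f << c *g k >> = c *: f k.
Proof.
rewrite (@lin_extEw _ _ [fset k]%fset) ?msuppU_le //.
by rewrite big_seq_fset1 mcoeffUU.
Qed.

Lemma eq_lin_ext f g x :
  (forall k, k \in msupp x -> f k = g k) -> lin_ext f x = lin_ext g x.
Proof.
move=> fg; rewrite /lin_ext big_seq_cond [RHS]big_seq_cond.
by apply: eq_bigr => k /andP[/fg-> _].
Qed.

Lemma lin_ext_lin f g a x :
  lin_ext (fun k => a *: f k + g k) x = a *: lin_ext f x + lin_ext g x.
Proof.
rewrite /lin_ext scaler_sumr -big_split; apply: eq_bigr => k _ /=.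
by module_ring.
Qed.

End LinearExtension.

Section AlgebraA.
Variable F : fieldType.
Implicit Types (x y z : algA F) (k : F * nat).

Definition addk k k' : F * nat := (k.1 + k'.1, (k.2 + k'.2)%N).
Definition predk k : F * nat := (k.1, k.2.-1).
Definition basisA k : algA F := << k >>.

Lemma addkC : commutative addk.
Proof. by move=> k k'; rewrite /addk addrC addnC. Qed.

Lemma monalgUZ c k : << c *g k >> = c *: basisA k.
Proof.
by apply/malgP => k'; rewrite mcoeffZ !mcoeffU mulrnAr mulr1.
Qed.

Lemma algA_ind (Q : algA F -> Prop) :
    Q 0 -> (forall a x y, Q x -> Q y -> Q (a *: x + y)) ->
  (forall k, Q (basisA k)) -> forall x, Q x.
Proof.
move=> Q0 QP QU x; rewrite [x]monalgE; elim/big_rec: _ => // k y _ Qy.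
by rewrite monalgUZ; apply: QP.
Qed.

Lemma mul_algAE x y :
  mul_algA x y = lin_ext (fun k => lin_ext (fun k' => basisA (addk k k')) y) x.
Proof.
rewrite mul_algA.unlock; apply: eq_bigr => k _; rewrite scaler_sumr.
by apply: eq_bigr => k' _; rewrite monalgUZ scalerA.
Qed.

Lemma der_algAE x :
  der_algA x =
    lin_ext (fun k => k.1 *: basisA k + k.2%:R *: basisA (predk k)) x.
Proof.
rewrite der_algA.unlock; apply: eq_bigr => k _.
by rewrite !(monalgUZ (_ * _)) scalerDr !scalerA.
Qed.

Fact mul_algA_bilinear : bilinear_for *:%R *:%R (@mul_algA F).
Proof.
split=> [z a x y | z a x y]; rewrite !mul_algAE ?linearP // -lin_ext_lin.
by apply: eq_lin_ext => k _; apply: linearP.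
Qed.

HB.instance Definition _ := bilinear_isBilinear.Build F (algA F) (algA F)
  (algA F) *:%R *:%R (@mul_algA F) mul_algA_bilinear.

Fact der_algA_linear : linear (@der_algA F).
Proof. by move=> a x y; rewrite !der_algAE linearP. Qed.

HB.instance Definition _ := GRing.isLinear.Build F (algA F) (algA F) *:%R
  (@der_algA F) der_algA_linear.

Lemma mul_algAUU k k' : mul_algA (basisA k) (basisA k') = basisA (addk k k').
Proof. by rewrite mul_algAE !lin_extU !scale1r. Qed.

Lemma der_algAU k :
  der_algA (basisA k) = k.1 *: basisA k + k.2%:R *: basisA (predk k).
Proof. by rewrite der_algAE lin_extU scale1r. Qed.

Lemma mul_algAC x y : mul_algA x y = mul_algA y x.
Proof.
elim/algA_ind: x => [|a x x' IH IH'|k]; first by rewrite linear0l linear0r.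
  by rewrite linearPl linearPr /= IH IH'.
elim/algA_ind: y => [|a y y' IH IH'|k']; first by rewrite linear0l linear0r.
  by rewrite linearPl linearPr /= IH IH'.
by rewrite !mul_algAUU addkC.
Qed.

(** The truncated predecessor is wrong only in degree 0, where the factor [k.2%:R] vanishes. *)
Lemma addk_predkl k k' :
  k.2%:R *: basisA (addk (predk k) k') = k.2%:R *: basisA (predk (addk k k')).
Proof. by case: k => a [|i] //=; rewrite !scale0r. Qed.

Lemma addk_predkr k k' :
  k'.2%:R *: basisA (addk k (predk k')) = k'.2%:R *: basisA (predk (addk k k')).
Proof. by rewrite addkC addk_predkl addkC. Qed.

Lemma der_mul_algA x y :
  der_algA (mul_algA x y) = mul_algA (der_algA x) y + mul_algA x (der_algA y).
Proof.
elim/algA_ind: x => [|a x x' IH IH'|k].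
- by rewrite linear0 !linear0l linear0 addr0.
- by rewrite !linearPl !linearP !linearPl /= IH IH'; module_ring.
elim/algA_ind: y => [|a y y' IH IH'|k'].
- by rewrite linear0 !linear0r linear0 addr0.
- by rewrite !linearPr !linearP !linearPr /= IH IH'; module_ring.
rewrite mul_algAUU !der_algAU linearPl linearZl linearPr linearZr /=.
rewrite !mul_algAUU.
rewrite addk_predkl addk_predkr /= natrD.
module_ring.
Qed.

End AlgebraA.

(** * The algebra N *)
Section Span.
Variables (F : fieldType) (S : {pred F * nat}).

(** Total in [k]: keys outside [S] give 0, so no membership proof has to be carried. *)
Definition basisS (k : F * nat) : spanA S := insubd 0 (basisA k).

Lemma val_basisS k : k \in S -> val (basisS k) = basisA k.
Proof. by move=> kS; rewrite val_insubd spanned_byU. Qed.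

Fact spanA_val_linear : linear (@spanA_val F S).
Proof. by []. Qed.

HB.instance Definition _ := GRing.isLinear.Build F (spanA S) (algA F) *:%R
  (@spanA_val F S) spanA_val_linear.

Lemma spanA_ind (Q : spanA S -> Prop) :
    Q 0 -> (forall a x y, Q x -> Q y -> Q (a *: x + y)) ->
  (forall k, k \in S -> Q (basisS k)) -> forall x, Q x.
Proof.
move=> Q0 QP QU x.
have -> : x = \sum_(k <- msupp (val x)) (val x)@_k *: basisS k.
  apply: val_inj; rewrite /= linear_sum [LHS]monalgE big_seq [RHS]big_seq.
  apply: eq_bigr => k kx; rewrite linearZ monalgUZ /= -val_basisS //.
  by have /allP := spanA_valP x; apply.
rewrite big_seq; elim/big_rec: _ => // k y kx Qy; apply: QP => //; apply: QU.
by have /allP := spanA_valP x; apply.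
Qed.

End Span.

Section AlgebraN.
Variables (F : fieldType) (Delta : zmodClosed F) (J : exponents).
Local Notation N := (algN Delta J).
Local Notation keys := (keysN Delta J).
Implicit Types (x y : N) (k : F * nat).

Definition basisN k : N := basisS keys k.

Lemma keysND k k' : k \in keys -> k' \in keys -> addk k k' \in keys.
Proof.
case/andP=> kD kJ /andP[kD' kJ'].
by apply/andP; split; [apply: rpredD | apply: exponentsD].
Qed.

Lemma keysN_pred k : k \in keys -> predk k \in keys.
Proof.
by case/andP=> kD kJ; apply/andP; split; last exact: exponents_pred_closed.
Qed.

Lemma keysN0 : (0, 0%N) \in keys.
Proof. by rewrite inE /= rpred0 exponents0. Qed.

Fact mulN_spanned x y : mul_algA (val x) (val y) \in spanned_by keys.
Proof. exact: mul_algA_spanned keysND (spanA_valP x) (spanA_valP y). Qed.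

Definition mulN x y : N := SpanA (mulN_spanned x y).

Fact derN_spanned x : der_algA (val x) \in spanned_by keys.
Proof. exact: der_algA_spanned keysN_pred (spanA_valP x). Qed.

Definition derN x : N := SpanA (derN_spanned x).

Fact mulN_bilinear : bilinear_for *:%R *:%R mulN.
Proof.
split=> z a x y; apply: val_inj.
  by rewrite /= ?linearPl ?linearPr /= ?linearPl ?linearPr.
by rewrite /= ?linearPl ?linearPr /= ?linearPl ?linearPr.
Qed.

HB.instance Definition _ := bilinear_isBilinear.Build F N N N *:%R *:%R
  mulN mulN_bilinear.

Fact derN_linear : linear derN.
Proof. by move=> a x y; apply: val_inj; rewrite /= !linearP. Qed.

HB.instance Definition _ := GRing.isLinear.Build F N N *:%R derN derN_linear.

Lemma mulNUU k k' : k \in keys -> k' \in keys ->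
  mulN (basisN k) (basisN k') = basisN (addk k k').
Proof.
move=> kN kN'; apply: val_inj.
by rewrite /= !val_basisS ?keysND // mul_algAUU.
Qed.

Lemma derNU k : k \in keys ->
  derN (basisN k) = k.1 *: basisN k + k.2%:R *: basisN (predk k).
Proof.
move=> kN; apply: val_inj.
by rewrite /= !val_basisS ?keysN_pred // der_algAU.
Qed.

Lemma der_mulN x y : derN (mulN x y) = mulN (derN x) y + mulN x (derN y).
Proof. by apply: val_inj; rewrite /= der_mul_algA. Qed.

Lemma mulNC x y : mulN x y = mulN y x.
Proof. by apply: val_inj; rewrite /= mul_algAC. Qed.

Lemma basisN0 : basisN (0, 0%N) = u00 Delta J.
Proof. by apply: val_inj; rewrite val_basisS ?keysN0. Qed.

Lemma mul1N x : mulN (u00 Delta J) x = x.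
Proof.
rewrite -basisN0.
elim/spanA_ind: x => [|a x y IH IH'|k kN]; first by rewrite linear0r.
  by rewrite linearPr /= IH IH'.
by rewrite mulNUU ?keysN0 // /addk add0r add0n -surjective_pairing.
Qed.

End AlgebraN.

HB.lock Definition dbN (F : fieldType) (Delta : zmodClosed F) (J : exponents)
  (b : F) (x : algN Delta J) : algN Delta J := derN x + b *: x.

Section DerivationN.
Variables (F : fieldType) (Delta : zmodClosed F) (J : exponents) (b : F).
Local Notation N := (algN Delta J).
Local Notation dbN := (@dbN F Delta J b).
Implicit Types (x y : N) (k : F * nat).

Lemma dbNE x : dbN x = derN x + b *: x.
Proof. by rewrite dbN.unlock. Qed.

Fact dbN_linear : linear dbN.
Proof. by move=> a x y; rewrite !dbNE linearP /=; module_ring. Qed.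

HB.instance Definition _ := GRing.isLinear.Build F N N *:%R dbN dbN_linear.

Lemma circNE x y : circN b x y = mulN x (dbN y).
Proof.
apply: val_inj; rewrite /= circ_algA.unlock dbNE linearDr /= linearZr /=.
by [].
Qed.

Lemma dbNU k : k \in keysN Delta J ->
  dbN (basisN Delta J k) =
    (k.1 + b) *: basisN Delta J k + k.2%:R *: basisN Delta J (predk k).
Proof. by move=> kN; rewrite !dbNE derNU //; module_ring. Qed.

Lemma der_dbN x : derN (dbN x) = dbN (derN x).
Proof. by rewrite !dbNE linearD linearZ. Qed.

Lemma db_mulN x y : dbN (mulN x y) = mulN (dbN x) y + mulN x (derN y).
Proof. by rewrite !dbNE der_mulN linearDl linearZl /=; module_ring. Qed.

End DerivationN.

(** * Multiplication operators on an irreducible module *)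
(** The pairs not covered by the generic rule have [a = c = - b] or [a + c = - b]. There the factor
    or the product of exponent [- b] is split through [g], and the conditions on [g] keep every
    regrouping generic. *)
Lemma multiplicative_extension (F : fieldType) (Delta : zmodClosed F) (b g : F)
    (T : Type) (m : F -> T -> T) :
    g \in Delta -> g != 0 -> g + b != 0 -> g + b + b != 0 ->
    (forall a c x, a \in Delta -> c \in Delta -> m a (m c x) = m c (m a x)) ->
    (forall e x, e \in Delta -> e + b = 0 -> m e x = m g (m (e - g) x)) ->
    (forall a c x, a \in Delta -> c \in Delta -> a + c + b != 0 ->
       (a + b != 0) || (c + b != 0) -> m a (m c x) = m (a + c) x) ->
  forall a c x, a \in Delta -> c \in Delta -> m a (m c x) = m (a + c) x.
Proof.
move=> gD g0 gb gbb mC special generic a c x aD cD.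
have [acb|acb] := eqVneq (a + c + b) 0; last first.
  have [ab|ab] := eqVneq (a + b) 0; last by rewrite generic // ab.
  have [cb|cb] := eqVneq (c + b) 0; last by rewrite generic // cb orbT.
  have agb : a + g + b = g by rewrite addrAC ab add0r.
  have -> : a + c = a + g + (c - g) by ring.
  rewrite (special c) // generic ?agb ?gb ?orbT // generic ?rpredB ?rpredD //.
    by have -> : a + g + (c - g) + b = a + c + b by ring.
  by rewrite agb g0.
have [a0|a0] := eqVneq a 0.
  move: acb; rewrite a0 !add0r => cb; rewrite (special c) //.
  by rewrite generic ?rpred0 ?rpredB // ?add0r ?gb ?orbT.
(* The product is split at [g]; writing [g = a + (g - a)] then lets [m a] come out, and the rest
   recombines to [m c]. *)
rewrite [RHS]special ?rpredD //.
have <- : a + (g - a) = g by ring.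
rewrite -generic ?rpredB //.
- have -> : a + c - (a + (g - a)) = a + c - g by ring.
  rewrite [m (g - a) _]generic ?rpredB ?rpredD //.
  + by have -> : g - a + (a + c - g) = c by ring.
  + have -> : g - a + (a + c - g) + b = a + c + b - a by ring.
    by rewrite acb sub0r oppr_eq0.
  + have -> : a + c - g + b = a + c + b - g by ring.
    by rewrite acb sub0r oppr_eq0 g0 orbT.
- by have -> : a + (g - a) + b = g + b by ring.
- have [ab|//] := eqVneq (a + b) 0.
  have -> : g - a + b = g + b + b - (a + b) by ring.
  by rewrite ab subr0 gbb.
Qed.

Section NovikovModule.
Variables (F : fieldType) (charF : [pchar F] =i pred0).
Variables (J : exponents) (Delta : zmodClosed F) (b : F) (M : lmodType F).
Variables (l : {bilinear algN Delta J -> M -> M})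
          (r : {bilinear M -> algN Delta J -> M}).
Hypothesis moduleM : novikov_module (@circN F Delta J b) l r.
Hypothesis irrM : irreducible_module l r.
Hypothesis nonzeroM : nonzero_action l r.

Local Notation N := (algN Delta J).
Local Notation keys := (keysN Delta J).
Local Notation u := (basisN Delta J).
Local Notation one := (u00 Delta J).
Local Notation D := (dbN b).
Local Notation pr a i := (@pair (GRing.Field.sort F) nat a i).
Implicit Types (x y v : N) (w : M) (k : F * nat).

Lemma natrS_neq0 n : n.+1%:R != 0 :> F.
Proof. by rewrite (pcharf0P F).1. Qed.

Lemma submodule_full (V : M -> Prop) w :
  novikov_submodule l r V -> V w -> w <> 0 -> forall w', V w'.
Proof.
move=> subV Vw w0 w'; apply: contrapT => Vw'; apply: irrM; exists V.
by split=> //; [exists w' | exists w].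
Qed.

Lemma r_comm w x y : r (r w x) y = r (r w y) x.
Proof. exact: (nm_N1_fix moduleM). Qed.

Lemma r_l w x y : r (l x w) y = l (mulN x (D y)) w.
Proof. by rewrite (nm_N1_swap moduleM) circNE. Qed.

Lemma r_r w x y :
  r (r w y) x - r w (mulN y (D x)) = l (mulN y (D x)) w - l y (r w x).
Proof. by rewrite -circNE (nm_N2_swap moduleM) r_l circNE. Qed.

(* The kernel of such a map is a submodule, and if it is 0 then both actions  *)
(* vanish.                                                                    *)
Lemma skew_intertwiner_eq0 (Z : {linear M -> M}) :
    (forall x w, Z (l x w) = 0) -> (forall w x, Z (r w x) = r (Z w) x) ->
    (forall w x, r (Z w) x = - l x (Z w)) ->
  forall w, Z w = 0.
Proof.
move=> Zl Zr Zskew.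
have kerZ : novikov_submodule l r (fun w => Z w = 0).
  split=> [|a w w' Zw Zw'|x w _|x w Zw]; first exact: linear0.
  - by rewrite linearP Zw Zw' scaler0 addr0.
  - exact: Zl.
  - by rewrite Zr Zw linear0l.
have [[w [Zw w0]]|injZ] := EM (exists w, Z w = 0 /\ w <> 0).
  exact: submodule_full kerZ Zw w0.
have inj w : Z w = 0 -> w = 0.
  by move=> Zw; apply: contrapT => w0; apply: injZ; exists w.
have l0 x w : l x w = 0 by apply: inj; apply: Zl.
by case: nonzeroM => x [w [] []] //; apply: inj; rewrite Zr Zskew l0 oppr0.
Qed.

(** As [D one = b *: one], N1 shows that the difference of the two sides kills the image of [l], and
    N2 gives the sign condition of [skew_intertwiner_eq0]. *)
Lemma r_one w : r w one = b *: w.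
Proof.
pose Z w := r w one - b *: w.
have ZP : linear Z by move=> a w1 w2; rewrite /Z linearPl /=; module_ring.
pose ZL := GRing.isLinear.Build F M M *:%R Z ZP.
pose Z' : {linear M -> M} := HB.pack Z ZL.
have D1 : D one = b *: one.
  by rewrite -basisN0 dbNU ?keysN0 //= scale0r addr0 add0r.
apply/eqP; rewrite -subr_eq0; apply/eqP.
apply: (@skew_intertwiner_eq0 Z') => [x w1|w1 x|w1 x]; rewrite /= /Z.
- by rewrite r_l D1 mulNC linearZl /= mul1N linearZl /=; module_ring.
- by rewrite r_comm linearBl /= linearZl.
have := r_r w1 one x; rewrite D1 mulNC linearZl /= mul1N linearZl linearZr /=.
rewrite linearBl /= linearZl linearBr /= linearZr /= r_comm => /eqP.
by rewrite subr_eq => /eqP->; module_ring.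
Qed.

Lemma r_ker_db z w : D z = 0 -> r w z = 0.
Proof.
move=> Dz0.
apply: (@skew_intertwiner_eq0 (applyr r z)) => [x w1|w1 x|w1 x].
- by rewrite /= r_l Dz0 !(linear0r, linear0l).
- by rewrite /= r_comm.
have := r_r w1 z x.
by rewrite Dz0 !(linear0r, linear0l) subr0 sub0r /= r_comm.
Qed.

Lemma l_one_r w x : l one (r w x) = r (l one w) x + r w (derN x).
Proof.
have := r_r w x one; rewrite r_one mul1N -[X in l X w]mul1N -r_l linearZl /=.
rewrite dbNE linearDr linearZr /= => e.
by rewrite -[LHS](subKr (r (l one w) x)) -e; module_ring.
Qed.


(** * The operators P through which both actions factor *)

Lemma exponents1_full i : 1%N \in (J : {pred nat}) -> i \in (J : {pred nat}).
Proof. by rewrite !inE; case: J. Qed.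

Lemma exponents1_eq0 i :
  1%N \notin (J : {pred nat}) -> i \in (J : {pred nat}) -> i = 0%N.
Proof. by rewrite !inE; case: J => //= _ /eqP. Qed.

(** These conditions make [D] invertible at the exponents [g] and [- b - g], and at [g + b], which
    is [g - a] for [a = - b] in [multiplicative_extension]. *)
Variable g : F.
Hypothesis gP : 1%N \notin (J : {pred nat}) ->
  [/\ g \in Delta, g != 0, g + b != 0 & g + b + b != 0].

(* Inverts D on the line of exponent a: solves                                *)
(* (a + b) P_{a,i} + i P_{a,i-1} = R_{a,i} for P_{a,i} when a + b <> 0.       *)
Fixpoint mult_invertible (a : F) (i : nat) (w : M) : M :=
  (a + b)^-1 *:
    (r w (u (a, i)) - if i is i'.+1 then i%:R *: mult_invertible a i' w else 0).

(** At exponent [- b] one has [D u_{-b,i+1} = (i+1) u_{-b,i}], which still determines the operator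
    if J = N. If J = {0}, then [u_{-b,0}] is not in the image of [D] and is factored into [u_{g,0}]
    and [u_{-b-g,0}], which are. *)
Definition mult_basis k w : M :=
  if k.1 + b != 0 then mult_invertible k.1 k.2 w else
  if 1%N \in (J : {pred nat}) then k.2.+1%:R^-1 *: r w (u (k.1, k.2.+1))
  else mult_invertible g 0 (mult_invertible (k.1 - g) 0 w).

Fact mult_invertible_linear a i : linear (mult_invertible a i).
Proof.
elim: i => [|i IH] c x y /=; rewrite linearPl /=; first by module_ring.
by rewrite IH; module_ring.
Qed.

Fact mult_basis_linear k : linear (mult_basis k).
Proof.
move=> c x y; rewrite /mult_basis; case: ifP => _.
  exact: mult_invertible_linear.
case: ifP => _; last by rewrite !mult_invertible_linear.
by rewrite linearPl /=; module_ring.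
Qed.

HB.instance Definition _ k := GRing.isLinear.Build F M M *:%R
  (mult_basis k) (mult_basis_linear k).

Definition mult x w : M := lin_ext (mult_basis^~ w) (val x).

Fact mult_bilinear : bilinear_for *:%R *:%R mult.
Proof.
split=> [w a x y|x a w w']; rewrite /mult /=; first by rewrite !linearP.
by rewrite -lin_ext_lin; apply: eq_lin_ext => k _; apply: linearP.
Qed.

HB.instance Definition _ := bilinear_isBilinear.Build F N M M *:%R *:%R
  mult mult_bilinear.

Lemma multU k w : k \in keys -> mult (u k) w = mult_basis k w.
Proof. by move=> kN; rewrite /mult val_basisS // lin_extU scale1r. Qed.

Lemma r_basisN k w : k \in keys ->
  r w (u k) = (k.1 + b) *: mult_basis k w + k.2%:R *: mult_basis (predk k) w.
Proof.
case: k => a i kN; rewrite /mult_basis /predk /=.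
case: ifPn => [ab|/negPn/eqP ab].
  case: i kN => [|i] kN /=; rewrite scalerA divff //; module_ring.
case: i kN => [|i] kN.
  (* Here [u (a, 0)] lies in the kernel of [D], so both sides vanish. *)
  by rewrite ab !scale0r addr0 r_ker_db // dbNU //= ab !scale0r addr0.
rewrite ab scale0r add0r; case: ifPn => J1 /=.
  by rewrite scalerA divff ?scale1r // natrS_neq0.
by case/andP: kN => _ /(exponents1_eq0 J1).
Qed.

Lemma r_mult w x : r w x = mult (D x) w.
Proof.
elim/spanA_ind: x => [|a x y IH IH'|k kN].
- by rewrite linear0r /= linear0 linear0l.
- by rewrite linearPr /= IH IH' linearP linearPl.
rewrite r_basisN // dbNU // linearPl linearZl /= !multU //.
exact: keysN_pred.
Qed.

(** On the line of exponent [a], [D] is triangular in the degree with diagonal entry [a + b]. When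
    this entry is 0, [D] lowers the degree with a nonzero factor, so it is still onto if J = N. *)
Lemma im_db_ind (Q : N -> Prop) :
    (forall a x y, Q x -> Q y -> Q (a *: x + y)) -> (forall x, Q (D x)) ->
  forall k, k \in keys -> (1%N \in (J : {pred nat})) || (k.1 + b != 0) ->
  Q (u k).
Proof.
move=> QP QD [a i] kN; rewrite /=; have [ab|ab] := eqVneq (a + b) 0.
  rewrite orbF => J1; have k'N : (a, i.+1) \in keys.
    by case/andP: kN => aD _; apply/andP; split=> //; apply: exponents1_full.
  suff -> : u (a, i) = D (i.+1%:R^-1 *: u (a, i.+1)) by [].
  rewrite linearZ /= dbNU //= ab scale0r add0r scalerA mulVf ?scale1r //.
  exact: natrS_neq0.
move=> _; elim: i kN => [|i IH] kN.
  suff -> : u (a, 0%N) = D ((a + b)^-1 *: u (a, 0%N)) by [].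
  by rewrite linearZ /= dbNU //= scale0r addr0 scalerA mulVf ?scale1r.
suff -> : u (a, i.+1) = (- (i.+1%:R / (a + b))) *: u (a, i)
    + D ((a + b)^-1 *: u (a, i.+1)).
  by apply: QP => //; apply: IH; apply: (keysN_pred kN).
rewrite linearZ /= dbNU //= /predk /= scalerDr !scalerA mulVf //; module_ring.
Qed.

(* If J = {0} then the image of D misses u_{-b,0} only. *)
Lemma algN_ind_db (Q : N -> Prop) :
    (forall a x y, Q x -> Q y -> Q (a *: x + y)) -> (forall x, Q (D x)) ->
    (forall c, c + b = 0 -> 1%N \notin (J : {pred nat}) ->
       (c, 0%N) \in keys -> (g, 0%N) \in keys -> (pr (c - g) 0%N) \in keys ->
       Q (u (g, 0%N)) -> Q (u (pr (c - g) 0%N)) -> Q (u (c, 0%N))) ->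
  forall x, Q x.
Proof.
move=> QP QD Qc; elim/spanA_ind => [||k kN] //.
  by have := QD 0; rewrite linear0.
have [J1|J1] := boolP (1%N \in (J : {pred nat})).
  by apply: im_db_ind => //; rewrite J1.
have [cb|cb] := eqVneq (k.1 + b) 0; last first.
  by apply: im_db_ind => //; rewrite cb orbT.
case: k kN cb => c i kN /= cb; case/andP: (kN) => /= cD iJ.
have [gD g0 gb gbb] := gP J1; have i0 := exponents1_eq0 J1 iJ; subst i.
have gk : (g, 0%N) \in keys by apply/andP.
have cgk : (pr (c - g) 0%N) \in keys by apply/andP; rewrite rpredB.
apply: Qc => //; apply: im_db_ind => //=; first by rewrite gb orbT.
by rewrite addrAC cb sub0r oppr_eq0 g0 orbT.
Qed.

Lemma mult_special c w : c + b = 0 -> 1%N \notin (J : {pred nat}) ->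
    (c, 0%N) \in keys -> (g, 0%N) \in keys -> (pr (c - g) 0%N) \in keys ->
  mult (u (c, 0%N)) w = mult (u (g, 0%N)) (mult (u (pr (c - g) 0%N)) w).
Proof.
move=> cb J1 cN gk cgk; have [gD g0 gb gbb] := gP J1.
rewrite !multU // /mult_basis /= cb eqxx (negPf J1) gb.
by rewrite addrAC cb sub0r oppr_eq0 g0.
Qed.

(** On the image of [D], [mult] is the right action and N1 applies; at the missing basis vector the
    property passes from the two factors. The next lemmas follow the same pattern. *)
Lemma r_mult_comm w x y : r (mult x w) y = mult x (r w y).
Proof.
elim/algN_ind_db: x w => [a x x' IH IH' w|x w|c cb J1 cN gk cgk IH IH' w].
- by rewrite !linearPl /= IH IH'.
- by rewrite -!r_mult r_comm.
- by rewrite !(mult_special _ cb) // IH IH'.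
Qed.

Lemma mult_comm w x y : mult x (mult y w) = mult y (mult x w).
Proof.
elim/algN_ind_db: x w => [a x x' IH IH' w|x w|c cb J1 cN gk cgk IH IH' w].
- by rewrite !linearPl linearPr /= IH IH'.
- by rewrite -!r_mult r_mult_comm.
- by rewrite !(mult_special _ cb) // IH' IH.
Qed.

Lemma l_mult w y : l y w = mult y (l one w).
Proof.
elim/algN_ind_db: y w => [a x x' IH IH' w|x w|c cb J1 cN gk cgk IH IH' w].
- by rewrite !linearPl /= IH IH'.
- by rewrite -r_mult r_l mul1N.
have [gD g0 gb gbb] := gP J1.
(* This makes [mult] at [u (g, 0)] a right action, which N1 merges with the left action of the other
   factor. *)
have ugE : u (g, 0%N) = D ((g + b)^-1 *: u (g, 0%N)).
  by rewrite linearZ /= dbNU //= scale0r addr0 scalerA mulVf ?scale1r.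
rewrite (mult_special _ cb) // -IH' {1}ugE -r_mult r_l -ugE mulNUU // /addk /=.
by rewrite subrK.
Qed.

Lemma l_one_mult w y : l one (mult y w) = mult y (l one w) + mult (derN y) w.
Proof.
elim/algN_ind_db: y w => [a x x' IH IH' w|x w|c cb J1 cN gk cgk IH IH' w].
- by rewrite linearP !linearPl /= linearPr /= IH IH'; module_ring.
- by rewrite -!r_mult der_dbN -r_mult l_one_r.
rewrite (mult_special _ cb) // IH IH' linearDr /= !derNU //=.
rewrite !scale0r !addr0 !linearZl /= linearZr /= !(mult_special _ cb) //.
by module_ring.
Qed.

Lemma mult_mulN_l w x y :
  mult (mulN x (D y)) (l one w) = mult x (mult (D y) (l one w)).
Proof. by rewrite -l_mult -r_l r_mult l_mult mult_comm. Qed.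

(** * Vanishing of the multiplicativity defect *)

Definition mult_defect x y w : M := mult x (mult y w) - mult (mulN x y) w.

(** This is N2 with all actions expressed through [mult] and [l one]; the terms in [l one w] cancel
    by [mult_mulN_l], and [D (x * D y)] expands by the twisted Leibniz rule [db_mulN]. *)
Lemma mult_defect_db x y w :
  mult_defect (D x) (D y) w + mult_defect x (derN (D y)) w = 0.
Proof.
have := r_r w y x; rewrite [l x _]l_mult l_one_r [l (mulN _ _) _]l_mult.
rewrite mult_mulN_l !r_mult db_mulN linearDr linearDl -der_dbN /= => /eqP.
rewrite -subr_eq0 mult_comm => /eqP e; rewrite -[RHS]e /mult_defect.
module_ring.
Qed.

Lemma mult_defectC x y w : mult_defect x y w = mult_defect y x w.
Proof. by rewrite /mult_defect mult_comm mulNC. Qed.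

Lemma mult_defectPl a c x y z w :
  mult_defect (a *: x + c *: y) z w =
    a *: mult_defect x z w + c *: mult_defect y z w.
Proof.
rewrite /mult_defect linearPl linearZl /= linearPl /= linearZl /=.
by rewrite linearPl linearZl /=; module_ring.
Qed.

Lemma mult_defectPr a c x y z w :
  mult_defect z (a *: x + c *: y) w =
    a *: mult_defect z x w + c *: mult_defect z y w.
Proof. by rewrite mult_defectC mult_defectPl !(mult_defectC z). Qed.

(** The relation [mult_defect_db] in coordinates. Its second argument runs over the image of [D],
    whence the condition on [k']. *)
Lemma mult_defect_basis k k' w : k \in keys -> k' \in keys ->
    (1%N \in (J : {pred nat})) || (k'.1 + b != 0) ->
  (k.1 + b + k'.1) *: mult_defect (u k) (u k') w
    + k.2%:R *: mult_defect (u (predk k)) (u k') w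
    + k'.2%:R *: mult_defect (u k) (u (predk k')) w = 0.
Proof.
move=> kN kN' good.
pose A y := mult_defect (D (u k)) y w + mult_defect (u k) (derN y) w.
have: A (u k') = 0.
  apply: (im_db_ind (Q := fun y => A y = 0)) => // [a x y IHx IHy|x].
    transitivity (a *: A x + A y); last by rewrite IHx IHy scaler0 addr0.
    have md z v1 v2 : mult_defect z (a *: v1 + v2) w =
        a *: mult_defect z v1 w + mult_defect z v2 w.
      by rewrite -[v2 in LHS]scale1r mult_defectPr scale1r.
    by rewrite /A linearP /= !md; module_ring.
  exact: mult_defect_db.
rewrite /A dbNU // derNU // mult_defectPl mult_defectPr => <-; module_ring.
Qed.

Lemma mult_defect_nat a c i j w :
    1%N \in (J : {pred nat}) -> a \in Delta -> c \in Delta ->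
  mult_defect (u (pr a i)) (u (pr c j)) w = 0.
Proof.
move=> J1 aD cD.
have kN e n : e \in Delta -> (pr e n) \in keys.
  by move=> eD; apply/andP; split; last exact: exponents1_full.
have E i' j' := mult_defect_basis w (kN a i' aD) (kN c j' cD)
  (introT orP (or_introl J1)).
rewrite /predk /= in E.
have [s0|s0] := eqVneq (a + b + c) 0.
  (* With the leading coefficient 0, the relation at degrees [0] and [j + 1] isolates the defect at
     [(0, j)]; then the first degree is raised by induction. *)
  rewrite s0 in E; elim: i j => [|i IH] j.
    have /eqP := E 0%N j.+1; rewrite !scale0r !add0r scaler_eq0.
    by rewrite (negPf (natrS_neq0 _)) => /eqP.
  have /eqP := E i.+1 j.+1.
  rewrite scale0r add0r IH scaler0 add0r scaler_eq0.
  by rewrite (negPf (natrS_neq0 _)) => /eqP.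
(* Otherwise the two remaining terms have smaller total degree. *)
have [n] := ubnP (i + j); elim: n i j => // n IH i j; rewrite ltnS => ijn.
have {}IH i' j' : (i' + j' < i + j)%N ->
    mult_defect (u (pr a i')) (u (pr c j')) w = 0.
  by move=> ij'; apply: IH; apply: leq_trans ij' ijn.
have := E i j.
have -> : i%:R *: mult_defect (u (pr a i.-1)) (u (pr c j)) w = 0.
  by case: i IH {ijn} => [|i] IH; rewrite ?scale0r // IH ?scaler0.
have -> : j%:R *: mult_defect (u (pr a i)) (u (pr c j.-1)) w = 0.
  by case: j IH {ijn} => [|j] IH; rewrite ?scale0r // IH ?scaler0 //= addnS.
by move=> /eqP; rewrite !addr0 scaler_eq0 (negPf s0) => /eqP.
Qed.

Lemma mult_zero_generic a c w :
    1%N \notin (J : {pred nat}) -> a \in Delta -> c \in Delta ->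
    a + c + b != 0 -> (a + b != 0) || (c + b != 0) ->
  mult (u (pr a 0%N)) (mult (u (pr c 0%N)) w) = mult (u (pr (a + c) 0%N)) w.
Proof.
move=> J1.
have kN e : e \in Delta -> (pr e 0%N) \in keys.
  by move=> eD; apply/andP; split; last exact: exponents0.
suff good a' c' : a' \in Delta -> c' \in Delta ->
    a' + c' + b != 0 -> c' + b != 0 ->
    mult (u (pr a' 0%N)) (mult (u (pr c' 0%N)) w) =
    mult (u (pr (a' + c') 0%N)) w.
  move=> aD cD acb /orP[ab|cb]; last exact: good.
  by rewrite mult_comm [a + c]addrC; apply: good; rewrite // [c + a]addrC.
move=> aD cD acb cb.
have := mult_defect_basis w (kN _ aD) (kN _ cD).
rewrite /= cb orbT => /(_ isT) /eqP; rewrite !scale0r !addr0 scaler_eq0.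
rewrite addrAC (negPf acb) /mult_defect mulNUU ?kN // subr_eq0 => /eqP.
by [].
Qed.

Lemma mult_zero a c w :
    1%N \notin (J : {pred nat}) -> a \in Delta -> c \in Delta ->
  mult (u (pr a 0%N)) (mult (u (pr c 0%N)) w) = mult (u (pr (a + c) 0%N)) w.
Proof.
move=> J1 aD cD; have [gD g0 gb gbb] := gP J1.
have kN e : e \in Delta -> (pr e 0%N) \in keys.
  by move=> eD; apply/andP; split; last exact: exponents0.
pose m e w1 := mult (u (pr e 0%N)) w1.
have mC a' c' w1 : a' \in Delta -> c' \in Delta ->
    m a' (m c' w1) = m c' (m a' w1) by move=> _ _; apply: mult_comm.
have m_special e w1 : e \in Delta -> e + b = 0 -> m e w1 = m g (m (e - g) w1).
  move=> eD eb; apply: (mult_special w1 eb J1 (kN _ eD) (kN _ gD) (kN _ _)).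
  by rewrite rpredB.
have m_generic a' c' w1 : a' \in Delta -> c' \in Delta -> a' + c' + b != 0 ->
    (a' + b != 0) || (c' + b != 0) -> m a' (m c' w1) = m (a' + c') w1.
  by move=> aD' cD' h1 h2; apply: (mult_zero_generic w1 J1 aD' cD' h1 h2).
exact: (multiplicative_extension gD g0 gb gbb mC m_special m_generic w aD cD).
Qed.

Lemma mult_mulN x y w : mult x (mult y w) = mult (mulN x y) w.
Proof.
elim/spanA_ind: x => [|e x x' IH IH'|[a i] kN]; first by rewrite !linear0l.
  by rewrite !linearPl /= IH IH'.
elim/spanA_ind: y => [|e y y' IH IH'|[c j] kN'].
- by rewrite !(linear0l, linear0r).
- by rewrite linearPl !linearPr /= linearPl /= IH IH'.
case/andP: (kN) (kN') => /= aD iJ /andP[/= cD jJ].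
have [J1|J1] := boolP (1%N \in (J : {pred nat})).
  by apply/eqP; rewrite -subr_eq0; apply/eqP/mult_defect_nat.
rewrite mulNUU // (exponents1_eq0 J1 iJ) (exponents1_eq0 J1 jJ).
exact: mult_zero.
Qed.

(** * The unit acts as the identity *)

Lemma l_one_mult1 w : l one (mult one w) = mult one (l one w).
Proof.
rewrite l_one_mult -basisN0 derNU ?keysN0 //= !scale0r addr0 linear0l.
by rewrite addr0.
Qed.

(** The kernel of [mult one] is a submodule, because this operator commutes with [l one] and every
    [mult x]. By idempotence it contains [mult one w - w]; were it everything, both actions would
    vanish. *)
Lemma mult1 w : mult one w = w.
Proof.
have ker1 : novikov_submodule l r (fun w => mult one w = 0).
  split=> [|a v v' IH IH'|x v IH|x v IH]; first exact: linear0r.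
  - by rewrite linearPr /= IH IH' scaler0 addr0.
  - by rewrite l_mult mult_comm -l_one_mult1 IH !linear0r.
  - by rewrite r_mult mult_comm IH linear0r.
apply/eqP; rewrite -subr_eq0; apply/eqP; apply: contrapT => w1.
have all0 : forall w', mult one w' = 0.
  apply: submodule_full ker1 _ w1.
  by rewrite linearBr /= mult_mulN mul1N subrr.
have mult0 x w' : mult x w' = 0 by rewrite -[x]mul1N -mult_mulN all0.
case: nonzeroM => x [w' []]; first by rewrite l_mult mult0.
by rewrite r_mult mult0.
Qed.

End NovikovModule.

(** * Eigenvectors and the isomorphism with M(lam) *)
Section Shifts.
Variables (F : fieldType) (V : lmodType F) (T : {linear V -> V}).
Implicit Types (s : seq F) (p : {poly F}) (x y : V).

Definition shifts s x : V := foldl (fun y a => T y - a *: y) x s.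

Fact shifts_linear s : linear (shifts s).
Proof.
elim: s => [|a s IH] c x y //=; rewrite /shifts /= -/(shifts _ _) -IH.
by congr (shifts _ _); rewrite linearP /=; module_ring.
Qed.

HB.instance Definition _ s := GRing.isLinear.Build F V V *:%R
  (shifts s) (shifts_linear s).

Lemma shifts_cons a s x : shifts (a :: s) x = shifts s (T x - a *: x).
Proof. by []. Qed.

Lemma shifts_cat s1 s2 x : shifts (s1 ++ s2) x = shifts s2 (shifts s1 x).
Proof. by rewrite /shifts foldl_cat. Qed.

Lemma shifts_comm1 s a x :
  shifts s (T x - a *: x) = T (shifts s x) - a *: shifts s x.
Proof.
elim: s x => [|c s IH] x //=; rewrite /shifts /= -!/(shifts _ _) -IH.
have TB y d : T (y - d *: x) = T y - d *: T x by rewrite linearB linearZ.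
by congr (shifts _ _); rewrite !TB; module_ring.
Qed.

Lemma shifts_comm s1 s2 x : shifts s1 (shifts s2 x) = shifts s2 (shifts s1 x).
Proof.
by elim: s2 x => [|a s IH] x //; rewrite !shifts_cons IH shifts_comm1.
Qed.

(** Applying the factors one at a time, the last nonzero vector is an eigenvector. [Q] allows the
    search to stay inside an invariant subspace such as a kernel. *)
Lemma exists_eigenvector (Q : V -> Prop) s x :
    (forall a y, Q y -> Q (T y - a *: y)) -> Q x -> x <> 0 -> shifts s x = 0 ->
  exists a y, [/\ Q y, y <> 0 & T y = a *: y].
Proof.
move=> QT; elim: s x => [|a s IH] x Qx x0 //= sx.
have [/eqP|Tx] := EM (T x - a *: x = 0).
  by rewrite subr_eq0 => /eqP Tx; exists a, x.
by apply: IH (T x - a *: x) _ Tx _ => //; apply: QT.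
Qed.

Definition poly_act (p : {poly F}) x : V := \sum_(i < size p) p`_i *: iter i T x.

Lemma poly_actEw n p x : (size p <= n)%N ->
  poly_act p x = \sum_(i < n) p`_i *: iter i T x.
Proof.
move=> pn; rewrite /poly_act (big_ord_widen n (fun i => p`_i *: iter i T x)) //.
rewrite big_mkcond; apply: eq_bigr => i _; case: ltnP => // ?.
by rewrite nth_default // scale0r.
Qed.

Lemma iter_linP n a x y : iter n T (a *: x + y) = a *: iter n T x + iter n T y.
Proof. by elim: n => // n IH; rewrite !iterS IH linearP. Qed.

Lemma poly_act_mulXsubC p a x :
  poly_act (('X - a%:P) * p) x = poly_act p (T x - a *: x).
Proof.
rewrite (@poly_actEw (size p).+1); last first.
  by rewrite (leq_trans (size_polyMleq _ _)) // size_XsubC.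
rewrite (eq_bigr (fun i : 'I_(size p).+1 =>
    ('X * p)`_i *: iter i T x - (a * p`_i) *: iter i T x)); last first.
  by move=> i _; rewrite mulrBl coefB coefCM scalerBl.
rewrite sumrB big_ord_recl big_ord_recr /= coefXM /= scale0r add0r.
rewrite [p`_(size p)]nth_default // mulr0 scale0r addr0 -sumrB.
apply: eq_bigr => i _; rewrite coefXM /= -iterS iterSr.
have -> : T x - a *: x = (- a) *: x + T x by module_ring.
by rewrite iter_linP !add0n scalerDr scalerA mulrN scaleNr addrC [p`_i * a]mulrC.
Qed.

Lemma poly_act_prod s x : poly_act (\prod_(a <- s) ('X - a%:P)) x = shifts s x.
Proof.
elim: s x => [|a s IH] x.
  by rewrite big_nil (@poly_actEw 1) ?size_poly1 // big_ord1 coef1 scale1r.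
by rewrite big_cons poly_act_mulXsubC IH.
Qed.

Lemma poly_actZ c p x : poly_act (c *: p) x = c *: poly_act p x.
Proof.
rewrite (@poly_actEw (size p)) ?size_scale_leq // scaler_sumr.
by apply: eq_bigr => i _; rewrite coefZ scalerA.
Qed.

(** The first [n + 1] iterates lie in the span of [n] vectors, so their coordinate matrix has a
    nonzero left kernel vector, whose entries are the coefficients of [p]. *)
Lemma finite_dimensional_poly_act x : finite_dimensional (iterate_span T x) ->
  exists2 p : {poly F}, p != 0 & poly_act p x = 0.
Proof.
case=> e [_ e_span]; pose n := size e.
have : forall m, exists c : nat -> F, iter m T x = \sum_(i < n) c i *: e`_i.
  move=> m; apply: e_span; exists m.+1, (fun i => (i == m)%:R).
  rewrite big_ord_recr /= eqxx scale1r big1 ?add0r // => i _.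
  by rewrite ltn_eqF ?scale0r.
move=> /choice[c cE]; pose A := \matrix_(i < n.+1, j < n) c i j.
have : kermx A != 0.
  by rewrite -mxrank_eq0 mxrank_ker subn_eq0 -ltnNge ltnS rank_leq_col.
case/rowV0Pn => v /sub_kermxP vA v0; exists (rVpoly v).
  apply: contraNneq v0 => pv; apply/eqP/rowP => i.
  by rewrite -coef_rVpoly_ord pv coef0 mxE.
rewrite (@poly_actEw n.+1) ?size_poly //.
rewrite (eq_bigr (fun i => \sum_(j < n) (v 0 i * A i j) *: e`_j)); last first.
  move=> i _; rewrite coef_rVpoly_ord cE scaler_sumr.
  by apply: eq_bigr => j _; rewrite scalerA mxE.
rewrite exchange_big big1 //= => j _; rewrite -scaler_suml.
have := congr1 (fun B : 'rV_n => B 0 j) vA; rewrite !mxE => ->.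
by rewrite scale0r.
Qed.

End Shifts.

Lemma finite_dimensional_shifts (F : closedFieldType) (V : lmodType F)
    (T : {linear V -> V}) x :
  finite_dimensional (iterate_span T x) -> exists s, shifts T s x = 0.
Proof.
case/finite_dimensional_poly_act => p p0; have [s ->] := closed_field_poly_normal p.
move/eqP; rewrite poly_actZ poly_act_prod scaler_eq0 lead_coef_eq0 (negPf p0) /=.
by move/eqP; exists s.
Qed.

(** * Eigenvectors of the derivation *)

Section DerivationEigenvectors.
Variable F : fieldType.
Hypothesis charF : [pchar F] =i pred0.
Implicit Types x : algA F.

Lemma mcoeff_basisA k k' : (basisA k)@_k' = (k == k')%:R :> F.
Proof. by rewrite mcoeffU. Qed.

Lemma mcoeff_der x a i :
  (der_algA x)@_(a, i) = a * x@_(a, i) + i.+1%:R * x@_(a, i.+1).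
Proof.
elim/algA_ind: x => [|c x y IHx IHy|[c j]].
- by rewrite linear0 !mcoeff0; ring.
- by rewrite linearP /= !mcoeffD !mcoeffZ IHx IHy; ring.
rewrite der_algAU mcoeffD !mcoeffZ !mcoeff_basisA /predk /= !xpair_eqE.
have [->|ca] := eqVneq c a; last by rewrite !mulr0.
case: j => [|j] /=; first by rewrite mul0r mulr0.
rewrite eqSS; have [->|] := eqVneq j i; first by [].
by rewrite !mulr0.
Qed.

(** Coefficients satisfy [(c - a) x_{a,i} = (i+1) x_{a,i+1}]. For [a] other than [c], vanishing
    descends from high degrees; for [a = c], characteristic 0 kills every positive degree. *)
Lemma der_eigenvector x c :
  der_algA x = c *: x -> x = x@_(c, 0%N) *: basisA (c, 0%N).
Proof.
move=> dx.
have rec a i : (c - a) * x@_(a, i) = i.+1%:R * x@_(a, i.+1).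
  by rewrite mulrBl -mcoeffZ -dx mcoeff_der; ring.
pose n := (\max_(k <- msupp x) k.2)%N.
have large a i : (n < i)%N -> x@_(a, i) = 0.
  move=> ni; apply: mcoeff_outdom; apply: contraL ni => kx.
  rewrite -leqNgt.
  exact: (@leq_bigmax_seq _ (enum_fset (msupp x)) predT snd (a, i) kx).
have off a i : a != c -> x@_(a, i) = 0.
  move=> ac; have [m] := ubnP (n.+1 - i); elim: m i => // m IH i.
  rewrite ltnS => im; have [/large//|ni] := ltnP n i.
  have := rec a i; rewrite (IH i.+1) ?mulr0; last first.
    by rewrite subSS (leq_trans _ im) // subSn.
  by move/eqP; rewrite mulf_eq0 subr_eq0 eq_sym (negPf ac) => /eqP.
apply/malgP => -[a i]; rewrite mcoeffZ mcoeff_basisA xpair_eqE.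
have [ca|ac] := eqVneq c a; last by rewrite mulr0 off // eq_sym.
subst a.
case: i => [|i] /=; first by rewrite mulr1.
rewrite mulr0; have := rec c i; rewrite subrr mul0r => /esym/eqP.
by rewrite mulf_eq0 (pcharf0P F).1 //= => /eqP.
Qed.

End DerivationEigenvectors.

(** In characteristic 0 the multiples of [d] are distinct, so [s] cannot contain all of them. *)
Lemma exists_notin (F : fieldType) (Delta : zmodClosed F) (s : seq F) :
    [pchar F] =i pred0 -> (exists2 d, d \in Delta & d != 0) ->
  exists2 g, g \in Delta & g \notin s.
Proof.
move=> charF [d dD d0]; apply: contrapT => noG.
pose t := [seq d *+ i | i <- iota 0 (size s).+1].
have t_uniq : uniq t.
  rewrite map_inj_uniq ?iota_uniq // => i j.
  wlog ij : i j / (i <= j)%N => [hw|].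
    by case/orP: (leq_total i j) => /hw // h /esym/h.
  move=> /esym/eqP; rewrite -subr_eq0 -mulrnBr // -mulr_natr mulf_eq0.
  by rewrite (negPf d0) /= (pcharf0P F).1 // subn_eq0 => ji; apply/eqP; rewrite eqn_leq ij.
have ts : {subset t <= s}.
  move=> e /mapP[i _ ->]; apply: contrapT => /negP es.
  by apply: noG; exists (d *+ i); rewrite ?rpredMn.
by have := uniq_leq_size t_uniq ts; rewrite size_map size_iota ltnn.
Qed.

(** * The isomorphism generated by an eigenvector *)

Section Isomorphism.
Variables (F : fieldType) (charF : [pchar F] =i pred0).
Variables (J : exponents) (Delta : zmodClosed F) (b lam : F) (M : lmodType F).
Local Notation N := (algN Delta J).
Local Notation keys := (keysN Delta J).
Local Notation Mlam := (modM Delta J lam).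
Local Notation ckeys := (coset_keys Delta J lam).
Local Notation u := (basisN Delta J).
Local Notation one := (u00 Delta J).
Local Notation D := (@dbN F Delta J b).

Variables (l : {bilinear N -> M -> M}) (r : {bilinear M -> N -> M}).
Variable mult : {bilinear N -> M -> M}.
Hypothesis irrM : irreducible_module l r.
Hypothesis mult_mulN : forall x y w, mult x (mult y w) = mult (mulN x y) w.
Hypothesis mult1 : forall w, mult one w = w.
Hypothesis l_mult : forall w x, l x w = mult x (l one w).
Hypothesis r_mult : forall w x, r w x = mult (D x) w.
Hypothesis l_one_mult :
  forall w x, l one (mult x w) = mult x (l one w) + mult (derN x) w.
Variable w : M.
Hypothesis w0 : w <> 0.
Hypothesis w_eigen : l one w = (lam + b) *: w.

Definition shiftk (k : F * nat) : F * nat := (k.1 - lam, k.2).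
(** Defined on all of A, where product and derivation are computed; keys outside the coset go to 0
    by the default value in [basisS]. *)
Definition orbit_mapA (x : algA F) : M :=
  lin_ext (fun k => mult (u (shiftk k)) w) x.

Fact orbit_mapA_linear : linear orbit_mapA.
Proof. by move=> a x y; apply: lin_extP. Qed.

HB.instance Definition _ := GRing.isLinear.Build F (algA F) M *:%R
  orbit_mapA orbit_mapA_linear.

Definition orbit_map (x : Mlam) : M := orbit_mapA (val x).

Fact orbit_map_linear : linear orbit_map.
Proof. by move=> a x y; rewrite /orbit_map /= !linearP. Qed.

HB.instance Definition _ := GRing.isLinear.Build F Mlam M *:%R
  orbit_map orbit_map_linear.

Lemma orbit_mapAU k : orbit_mapA (basisA k) = mult (u (shiftk k)) w.
Proof. by rewrite /orbit_mapA lin_extU scale1r. Qed.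

Lemma shiftk_keys k : k \in ckeys -> shiftk k \in keys.
Proof. by []. Qed.

Lemma orbit_map_mul (v : N) (x : Mlam) :
  orbit_mapA (mul_algA (val v) (val x)) = mult v (orbit_mapA (val x)).
Proof.
elim/spanA_ind: v => [|a v v' IH IH'|k kN].
- by rewrite /= !(linear0l, linear0).
- by rewrite /= !linearPl linearP /= IH IH'.
elim/spanA_ind: x => [|a x x' IH IH'|k' kN'].
- by rewrite /= !(linear0r, linear0).
- by rewrite /= linearPr !linearP ?linearPr /= IH IH'.
rewrite !val_basisS // mul_algAUU !orbit_mapAU mult_mulN mulNUU ?shiftk_keys //.
by rewrite /shiftk /addk /= addrA.
Qed.

(** On the image of [u k], [l one] produces [lam + b] from [w] and [k.1 - lam] from the derivation,
    so the shift by [lam] cancels. *)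
Lemma orbit_map_der (x : Mlam) :
  orbit_mapA (der_algA (val x)) =
    l one (orbit_mapA (val x)) - b *: orbit_mapA (val x).
Proof.
elim/spanA_ind: x => [|a x x' IH IH'|k kN].
- by rewrite /= !(linear0r, linear0) ?addr0.
- rewrite /= linearP linearP /= IH IH'.
  rewrite [orbit_mapA (_ *: _ + _)]linearP linearPr /=.
  by module_ring.
rewrite !val_basisS // der_algAU linearP linearZ /= !orbit_mapAU.
rewrite l_one_mult w_eigen linearZr derNU ?shiftk_keys // linearPl linearZl /=.
have -> : predk (shiftk k) = shiftk (predk k) by [].
by rewrite /=; module_ring.
Qed.

Lemma orbit_map_db (x : Mlam) :
  orbit_mapA (der_algA (val x) + b *: val x) = l one (orbit_mapA (val x)).
Proof. by rewrite linearD linearZ /= orbit_map_der subrK. Qed.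

Lemma circ_algAE (x y : algA F) :
  circ_algA b x y = mul_algA x (der_algA y + b *: y).
Proof. by rewrite circ_algA.unlock linearDr linearZr. Qed.

Lemma orbit_map_l v x : orbit_map (lactM b v x) = l v (orbit_map x).
Proof.
have dx : der_algA (val x) + b *: val x \in spanned_by ckeys.
  rewrite rpredD ?rpredZ ?(spanA_valP x) //.
  exact: der_algA_spanned (@coset_keys_der _ _ _ _) (spanA_valP x).
rewrite /orbit_map /= circ_algAE l_mult -orbit_map_db.
exact: (orbit_map_mul v (SpanA dx)).
Qed.

Lemma orbit_map_r x v : orbit_map (ractM b x v) = r (orbit_map x) v.
Proof.
rewrite /orbit_map r_mult -orbit_map_mul /= circ_algAE mul_algAC.
by congr (orbit_mapA (mul_algA _ _)); rewrite dbNE.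
Qed.

Lemma orbit_map_surj m : exists x, orbit_map x = m.
Proof.
have subV : novikov_submodule l r (fun m => exists x, orbit_map x = m).
  split=> [|a _ _ [x <-] [y <-]|v _ [x <-]|v _ [x <-]].
  - by exists 0; rewrite linear0.
  - by exists (a *: x + y); rewrite linearP.
  - by exists (lactM b v x); rewrite orbit_map_l.
  - by exists (ractM b x v); rewrite orbit_map_r.
apply: (submodule_full irrM subV _ w0).
have lamN : (lam, 0%N) \in ckeys.
  by apply/andP; rewrite /= subrr rpred0; split=> //; apply: exponents0.
exists (basisS ckeys (lam, 0%N)).
rewrite /orbit_map val_basisS // orbit_mapAU /shiftk /= subrr.
by rewrite basisN0 mult1.
Qed.

Lemma mul_basis0 (x : algA F) : mul_algA (basisA (0, 0%N)) x = x.
Proof.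
elim/algA_ind: x => [|a x y IH IH'|k]; first by rewrite linear0r.
  by rewrite linearPr /= IH IH'.
by rewrite mul_algAUU /addk add0r add0n -surjective_pairing.
Qed.

Lemma lact_oneE (x : Mlam) :
  val (lactM b one x) = der_algA (val x) + b *: val x.
Proof. by rewrite /= circ_algAE -[LHS]mul_basis0 mul_basis0 mul_basis0. Qed.

Fact lact_one_linear : linear (lactM (lam := lam) b one).
Proof.
move=> a x y; apply: val_inj.
transitivity (a *: val (lactM b one x) + val (lactM b one y)); last by [].
by rewrite !lact_oneE /= linearP /=; module_ring.
Qed.

HB.instance Definition _ := GRing.isLinear.Build F Mlam Mlam *:%R
  (lactM (lam := lam) b one) lact_one_linear.

(** On [u_{a,i}] the operator minus [a + b] gives [i u_{a,i-1}], so [i + 1] shifts suffice; for sums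
    the lists are concatenated, as shifts commute. *)
Lemma modM_shifts (x : Mlam) :
  exists s, shifts (lactM (lam := lam) b one) s x = 0.
Proof.
elim/spanA_ind: x => [|a x y [s sx] [t ty]|[a i] kN].
- by exists [::].
- exists (s ++ t); rewrite shifts_cat linearP /= sx scaler0 add0r shifts_comm ty.
  by rewrite linear0.
exists (nseq i.+1 (a + b)); elim: i kN => [|i IH] kN; rewrite shifts_cons.
  suff -> : lactM b one (basisS ckeys (a, 0%N))
      - (a + b) *: basisS ckeys (a, 0%N) = 0 by rewrite linear0.
  apply: val_inj; transitivity (val (lactM b one (basisS ckeys (a, 0%N)))
    - (a + b) *: val (basisS ckeys (a, 0%N))); first by [].
  rewrite lact_oneE val_basisS // der_algAU /= scale0r addr0.
  by rewrite -scalerDl subrr.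
have kN' := coset_keys_der kN.
have -> : lactM b one (basisS ckeys (a, i.+1))
      - (a + b) *: basisS ckeys (a, i.+1)
    = i.+1%:R *: basisS ckeys (a, i).
  apply: val_inj; transitivity (val (lactM b one (basisS ckeys (a, i.+1)))
    - (a + b) *: val (basisS ckeys (a, i.+1))); first by [].
  transitivity (i.+1%:R *: val (basisS ckeys (a, i))); last by [].
  by rewrite lact_oneE !val_basisS // der_algAU /predk /=; module_ring.
by rewrite linearZ -[RHS](scaler0 _ i.+1%:R); congr (_ *: _); apply: IH kN'.
Qed.

Lemma orbit_map_eq0 (x : Mlam) : orbit_map x = 0 -> x = 0.
Proof.
move=> phix; apply: contrapT => x0; have [s sx] := modM_shifts x.
have QT a (y : Mlam) : orbit_map y = 0 ->
      orbit_map (lactM b one y - a *: y) = 0.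
  by move=> y0; rewrite linearB linearZ /= orbit_map_l y0 linear0r scaler0 subr0.
have [c [y [phiy y0 Ty]]] := exists_eigenvector QT phix x0 sx.
have dy : der_algA (val y) = (c - b) *: val y.
  have := congr1 val Ty; rewrite lact_oneE [RHS]linearZ /= => e.
  by rewrite -[LHS](addrK (b *: spanA_val y)) e; module_ring.
have := der_eigenvector charF dy; set a := mcoeff _ _ => yE.
have a0 : a != 0.
  by apply: contra_notN y0 => /eqP a0; apply: val_inj; rewrite yE a0 scale0r.
have cN : (c - b, 0%N) \in ckeys.
  by have /allP := spanA_valP y; apply; rewrite -mcoeff_neq0.
apply: w0; apply/eqP; move/eqP: phiy.
rewrite /orbit_map yE linearZ /= scaler_eq0 (negPf a0) /= orbit_mapAU => /eqP.
(* The operator at the opposite exponent inverts the one at [c - b - lam], which leaves [w = 0]. *)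
move/(congr1 (mult (u (- (c - b - lam), 0%N)))).
have c'N : (- (c - b - lam), 0%N) \in keys.
  by case/andP: cN => cD cJ; apply/andP; rewrite rpredN.
rewrite linear0r mult_mulN mulNUU // /addk /= addNr addn0 basisN0 mult1.
by move/eqP.
Qed.

Lemma orbit_map_iso : module_isomorphic l r
  (@lactM F Delta J b lam) (@ractM F Delta J b lam).
Proof.
have inj x y : orbit_map x = orbit_map y -> x = y.
  move=> /eqP; rewrite -subr_eq0 -linearB => /eqP /orbit_map_eq0 /eqP.
  by rewrite subr_eq0 => /eqP.
pose f m := sval (cid (orbit_map_surj m)).
have fK m : orbit_map (f m) = m by rewrite /f; case: cid.
have Kf x : f (orbit_map x) = x by apply: inj; rewrite fK.
have fP : linear f by move=> a x y; apply: inj; rewrite linearP /= !fK.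
pose fL := GRing.isLinear.Build F M Mlam *:%R f fP.
pose f' : {linear M -> Mlam} := HB.pack f fL.
exists f'; split=> [|v m|m v] /=; first by exists orbit_map.
- by apply: inj; rewrite orbit_map_l !fK.
- by apply: inj; rewrite orbit_map_r !fK.
Qed.

End Isomorphism.

Theorem theorem4p3 (F : closedFieldType) (charF : [pchar F] =i pred0)
    (J : exponents) (Delta : zmodClosed F)
    (nontrivial : ~ ((J : {pred nat}) =i pred1 0%N /\ Delta =i pred1 (0 : F)))
    (b : F) (M : lmodType F)
    (l : {bilinear algN Delta J -> M -> M})
    (r : {bilinear M -> algN Delta J -> M})
    (moduleM : novikov_module (@circN F Delta J b) l r)
    (irrM : irreducible_module l r)
    (nonzeroM : nonzero_action l r)
    (locfinM : locally_finite (l (u00 Delta J))) :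
  exists lam : F,
    module_isomorphic l r (@lactM F Delta J b lam) (@ractM F Delta J b lam).
Proof.
have [g gP] : exists g, 1%N \notin (J : {pred nat}) ->
    [/\ g \in Delta, g != 0, g + b != 0 & g + b + b != 0].
  have [J1|J1] := boolP (1%N \in (J : {pred nat})); first by exists 0.
  have [d dD d0] : exists2 d, d \in Delta & d != 0.
    apply: contrapT => noD; apply: nontrivial; split=> [i|d].
      by move: J1; rewrite !inE; case: (J).
    rewrite inE; apply/idP/eqP => [dD|->]; last exact: rpred0.
    by apply/eqP; apply: contrapT => /negP d0; apply: noD; exists d.
  have [|g gD] := @exists_notin F Delta [:: 0; - b; - b - b] charF.
    by exists d.
  rewrite !inE !negb_or => /and3P[g0 gb gbb]; exists g => _; split=> //.
    by rewrite addr_eq0.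
  by rewrite -addrA addr_eq0 opprD.
have [w w0] : exists w : M, w <> 0.
  by case: nonzeroM => x [w [lw|rw]]; [exists (l x w) | exists (r w x)].
have [s sw] := finite_dimensional_shifts (locfinM w).
have [||c [v [_ v0 Tv]]] :=
  @exists_eigenvector _ _ _ (fun _ => True) s w _ _ w0 sw => //.
(* In [M(lam)] the vector [u_{lam,0}] has eigenvalue [lam + b] under [u_{0,0}], which has to match
   [c]. *)
exists (c - b).
pose m : {bilinear algN Delta J -> M -> M} := mult b r g.
apply: (@orbit_map_iso F charF J Delta b (c - b) M l r m irrM _ _ _ _ _ v v0).
- by move=> *; apply: (mult_mulN charF moduleM irrM nonzeroM gP).
- by move=> *; apply: (mult1 charF moduleM irrM nonzeroM gP).
- by move=> *; apply: (l_mult charF moduleM irrM nonzeroM gP).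
- by move=> *; apply: (r_mult charF moduleM irrM nonzeroM g).
- by move=> *; apply: (l_one_mult charF moduleM irrM nonzeroM gP).
by rewrite subrK.
Qed.
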